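(* The group $\mathrm{F}_4$ acts transitively on $\widehat{\mathbb{OP}}{}^2_0$. For every $A\in \widehat{\mathbb{OP}}{}^2_0$ there exists $g\in\mathrm{F}_4$ such that $$g\cdot A=\begin{pmatrix} i & 1 & 0\\ 1 & -i & 0\\ 0&0&0\end{pmatrix}.$$
   Context: Let $\mathbb{O}=\mathbb{O}_{\mathbb R}\otimes_{\mathbb R}\mathbb{C}$ be the complex octonion algebra, where $\mathbb{O}_{\mathbb R}$ is the classical real algebra of octonions; multiplication is $(o_1\otimes z_1)(o_2\otimes z_2)=o_1o_2\otimes z_1z_2$ and conjugation is the $\mathbb{C}$-linear map $\overline{o\otimes z}=\bar o\otimes z$. Complex numbers are identified with $1\otimes\mathbb{C}\subset\mathbb{O}$, and $i$ is the imaginary unit of $\mathbb{C}$. $\mathrm{Herm}(3,\mathbb{O})$ is the 27-dimensional complex vector space of $3\times 3$ matrices $A$ over $\mathbb{O}$ with $\bar A^T=A$ (so its diagonal entries lie in $\mathbb{C}$). With the product $A\circ B=\frac12(AB+BA)$ it is the complex exceptional Jordan algebra $\mathcal{J}_3(\mathbb{O})$. The complex Lie group $\mathrm{F}_4$ is the automorphism group of this algebra: the subgroup of those $g\in \mathrm{GL}(27,\mathbb{C})$ (complex-linear automorphisms of $\mathrm{Herm}(3,\mathbb{O})$) with $g(A\circ B)=gA\circ gB$ for all $A,B$; it preserves the trace. Define $$\widehat{\mathbb{OP}}{}^2_0=\{A\in\mathrm{Herm}(3,\mathbb{O}) : A^2=0,\ \mathrm{tr}A=0,\ A\neq 0\},$$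 on which $\mathrm{F}_4$ acts by $g\cdot A=gA$. *)

(* Defs.v *)
From HB Require Import structures.
From mathcomp Require Import all_boot all_order all_algebra.
From mathcomp Require Import complex reals.
Set Implicit Arguments.
Unset Strict Implicit.
Unset Printing Implicit Defensive.
Import GRing.Theory.
Local Open Scope ring_scope.

(* Cayley-Dickson doubling starting from the ring K itself with the identity
   as conjugation: (a, b)(c, d) = (ac - d^* b, da + b c^* ) and
   (a, b)^* = (a^*, - b).  Three doublings of the reals give the classical
   octonions.  The structure constants are integers and the conjugation is
   K-linear, so for K = C the result is the complexification of the real one
   (lemmas octtens_mul, octtens_conj, octtens_dec); in particular complex
   conjugation plays no role. *)
Fixpoint cddim (k : nat) : nat :=
  if k is k'.+1 then (cddim k' + cddim k')%N else 1%N.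

Section CayleyDickson.
Variable K : comNzRingType.

Fixpoint cdconj k : 'rV[K]_(cddim k) -> 'rV[K]_(cddim k) :=
  match k with
  | 0 => id
  | k'.+1 => fun x : 'rV_(cddim k' + cddim k') =>
      row_mx (cdconj (lsubmx x)) (- rsubmx x)
  end.

Fixpoint cdmul k : 'rV[K]_(cddim k) -> 'rV[K]_(cddim k) -> 'rV[K]_(cddim k) :=
  match k with
  | 0 => fun x y : 'M_1 => x *m y
  | k'.+1 => fun x y : 'rV_(cddim k' + cddim k') =>
      let a := lsubmx x in let b := rsubmx x in
      let c := lsubmx y in let d := rsubmx y in
      row_mx (cdmul a c - cdmul (cdconj d) b) (cdmul d a + cdmul b (cdconj c))
  end.

Fixpoint cdone k : 'rV[K]_(cddim k) :=
  match k with
  | 0 => 1%:M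
  | k'.+1 => row_mx (cdone k') 0
  end.

Lemma cdconj_linear k : linear (@cdconj k).
Proof.
elim: k => [|k IHk] a x y //=.
by rewrite scale_row_mx add_row_mx !linearP IHk.
Qed.

HB.instance Definition _ k :=
  GRing.isLinear.Build K 'rV[K]_(cddim k) 'rV[K]_(cddim k) *:%R (@cdconj k)
    (@cdconj_linear k).

Lemma cdconjZ k a (x : 'rV[K]_(cddim k)) : cdconj (a *: x) = a *: cdconj x.
Proof. exact: linearZ. Qed.

Lemma cdconjN k (x : 'rV[K]_(cddim k)) : cdconj (- x) = - cdconj x.
Proof. exact: linearN. Qed.

Lemma cdconjB k (x y : 'rV[K]_(cddim k)) : cdconj (x - y) = cdconj x - cdconj y.
Proof. exact: linearB. Qed.

Lemma cdmul_bilinear k :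
  (forall x, linear (@cdmul k x)) /\ (forall y, linear ((@cdmul k)^~ y)).
Proof.
elim: k => [|k [IHr IHl]]; split=> [x a u v|y a u v] /=.
- by rewrite linearP.
- by rewrite mulmxDl -scalemxAl.
- rewrite scale_row_mx add_row_mx !linearP !IHr !IHl; congr row_mx.
    by rewrite scalerBr opprD addrACA.
  by rewrite scalerDr addrACA.
- rewrite scale_row_mx add_row_mx !linearP !IHr !IHl; congr row_mx.
    by rewrite scalerBr opprD addrACA.
  by rewrite scalerDr addrACA.
Qed.

HB.instance Definition _ k x :=
  GRing.isLinear.Build K 'rV[K]_(cddim k) 'rV[K]_(cddim k) *:%R (@cdmul k x)
    ((@cdmul_bilinear k).1 x).

Lemma cdmulZl k a (x y : 'rV[K]_(cddim k)) : cdmul (a *: x) y = a *: cdmul x y.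
Proof.
have l := (@cdmul_bilinear k).2 y.
have l0 : cdmul 0 y = 0.
  by have := l (-1) 0 0; rewrite scaler0 addr0 scaleN1r addNr.
by have := l a x 0; rewrite l0 !addr0.
Qed.

Lemma cdmulZr k a (x y : 'rV[K]_(cddim k)) : cdmul x (a *: y) = a *: cdmul x y.
Proof. exact: linearZ. Qed.

Lemma cdmulNl k (x y : 'rV[K]_(cddim k)) : cdmul (- x) y = - cdmul x y.
Proof. by rewrite -scaleN1r cdmulZl scaleN1r. Qed.

Lemma cdmulNr k (x y : 'rV[K]_(cddim k)) : cdmul x (- y) = - cdmul x y.
Proof. exact: linearN. Qed.

Lemma cdmulDl k (x x' y : 'rV[K]_(cddim k)) :
  cdmul (x + x') y = cdmul x y + cdmul x' y.
Proof. by have := (@cdmul_bilinear k).2 y 1 x x'; rewrite !scale1r. Qed.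

Lemma cdmul0l k (y : 'rV[K]_(cddim k)) : cdmul 0 y = 0.
Proof. by rewrite -[X in cdmul X](scale0r y) cdmulZl scale0r. Qed.

Lemma cdconjK k : involutive (@cdconj k).
Proof.
by elim: k => [|k IHk] x //=; rewrite row_mxKl row_mxKr IHk opprK hsubmxK.
Qed.

Lemma cdconjM k (x y : 'rV[K]_(cddim k)) :
  cdconj (cdmul x y) = cdmul (cdconj y) (cdconj x).
Proof.
elim: k x y => [|k IHk] x y /=.
  by rewrite -[LHS]trmxK trmx_mul [x]mx11_scalar [y]mx11_scalar !tr_scalar_mx
             -scalar_mxM tr_scalar_mx scalar_mxM.
rewrite !row_mxKl !row_mxKr cdconjB !IHk !cdconjK cdconjN !cdmulNl !cdmulNr.
by congr row_mx; rewrite ?opprK // opprD addrC.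
Qed.

Lemma cdconj1 k : cdconj (cdone k) = cdone k.
Proof. by elim: k => [|k IHk] //=; rewrite row_mxKl row_mxKr IHk oppr0. Qed.

Lemma cdmul1 k : left_id (cdone k) (@cdmul k) /\ right_id (cdone k) (@cdmul k).
Proof.
elim: k => [|k [IHl IHr]].
  by split=> x /=; rewrite ?mul1mx ?mulmx1.
split=> x /=; rewrite row_mxKl row_mxKr ?cdconj1 ?linear0.
  by rewrite cdmul0l IHl IHr !addr0 hsubmxK.
by rewrite !cdmul0l !IHr subr0 add0r hsubmxK.
Qed.

End CayleyDickson.

Definition oct (K : comNzRingType) := 'rV[K]_(cddim 3).

(* Locked, because unification otherwise unfolds the three doublings. *)
HB.lock Definition octmul (K : comNzRingType) (x y : oct K) : oct K := cdmul x y.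

Section Octonions.
Variable K : comNzRingType.

Definition octconj (x : oct K) : oct K := cdconj x.
HB.instance Definition _ :=
  GRing.isLinear.Build K (oct K) (oct K) *:%R octconj (@cdconj_linear K 3).

Lemma octconjM (x y : oct K) : octconj (octmul x y) = octmul (octconj y) (octconj x).
Proof. by rewrite unlock; exact: cdconjM. Qed.

(* The identification of K with the scalars of the octonions. *)
Definition octscal (z : K) : oct K := z *: cdone K 3.

Definition octmx_mul (A B : 'M[oct K]_3) : 'M[oct K]_3 :=
  \matrix_(i, j) \sum_k octmul (A i k) (B k j).
Definition octmx_scale (a : K) (A : 'M[oct K]_3) : 'M[oct K]_3 :=
  map_mx (fun x : oct K => a *: x) A.

Lemma octmx_mulE A B i j :
  octmx_mul A B i j = \sum_k octmul (A i k) (B k j).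
Proof. exact: mxE. Qed.

Lemma octmx_scaleE a A i j : octmx_scale a A i j = a *: (A i j : oct K).
Proof. exact: mxE. Qed.

Definition octmx_herm : pred 'M[oct K]_3 := fun A => (map_mx octconj A)^T == A.

End Octonions.

Arguments octscal {K} z.

Section Complexification.
Variable R : realType.
Local Notation C := R[i].

Definition octtens (o : oct R) (z : C) : oct C :=
  z *: map_mx (real_complex R) o.

Lemma map_cdconj k (x : 'rV[R]_(cddim k)) :
  cdconj (map_mx (real_complex R) x) = map_mx (real_complex R) (cdconj x).
Proof.
elim: k x => [|k IHk] x //=.
by rewrite map_row_mx map_mxN -map_lsubmx -map_rsubmx IHk.
Qed.

Lemma map_cdmul k (x y : 'rV[R]_(cddim k)) :
  cdmul (map_mx (real_complex R) x) (map_mx (real_complex R) y)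
  = map_mx (real_complex R) (cdmul x y).
Proof.
elim: k x y => [|k IHk] x y /=; first by rewrite map_mxM.
rewrite map_row_mx map_mxB map_mxD -!map_lsubmx -!map_rsubmx !map_cdconj.
by rewrite !IHk.
Qed.

Lemma octtens_mul o1 o2 z1 z2 :
  octmul (octtens o1 z1) (octtens o2 z2) = octtens (octmul o1 o2) (z1 * z2).
Proof. by rewrite !octmul.unlock /octtens cdmulZl cdmulZr scalerA map_cdmul. Qed.

Lemma octtens_conj o z : octconj (octtens o z) = octtens (octconj o) z.
Proof. by rewrite /octconj /octtens cdconjZ map_cdconj. Qed.

Lemma octtens_dec :
  bijective (fun p : oct R * oct R => octtens p.1 1 + octtens p.2 'i%C).
Proof.
pose g (x : oct C) : oct R * oct R :=
  (map_mx (@complex.Re R) x, map_mx (@complex.Im R) x).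
exists g => [[x y]|x]; last first.
  by apply/rowP=> j; rewrite !mxE mul1r -complexE.
by congr pair; apply/rowP=> j; rewrite !mxE; simpc.
Qed.

End Complexification.

Section Hermitian.
Variable K : fieldType.

Record herm3 := Herm3 { hmx :> 'M[oct K]_3; _ : octmx_herm hmx }.

HB.instance Definition _ := [isSub for hmx].
HB.instance Definition _ := [Choice of herm3 by <:].

Fact octmx_herm_zmod : zmod_closed (@octmx_herm K).
Proof.
split=> [|A B /eqP hA /eqP hB]; rewrite unfold_in; apply/eqP/matrixP=> i j.
  by rewrite !mxE linear0.
by rewrite !mxE linearB -{2}hA -{2}hB !mxE.
Qed.
HB.instance Definition _ :=
  GRing.isZmodClosed.Build 'M[oct K]_3 (@octmx_herm K) octmx_herm_zmod.
HB.instance Definition _ := [SubChoice_isSubZmodule of herm3 by <:].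

Lemma hermP (A : herm3) i j : octconj (A j i) = A i j.
Proof. by case: A => A /= /eqP {2}<-; rewrite !mxE. Qed.

Fact herm_scale_subproof a (A : herm3) : octmx_herm (octmx_scale a A).
Proof.
by apply/eqP/matrixP=> i j; rewrite !mxE linearZ /= hermP.
Qed.
Definition herm_scale a (A : herm3) : herm3 := Herm3 (herm_scale_subproof a A).

Fact herm_scaleA a b A : herm_scale a (herm_scale b A) = herm_scale (a * b) A.
Proof. by apply/val_inj/matrixP=> i j; rewrite !mxE scalerA. Qed.
Fact herm_scale1 : left_id 1 herm_scale.
Proof. by move=> A; apply/val_inj/matrixP=> i j; rewrite !mxE scale1r. Qed.
Fact herm_scaleDr : right_distributive herm_scale +%R.
Proof. by move=> a A B; apply/val_inj/matrixP=> i j; rewrite !mxE scalerDr. Qed.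
Fact herm_scaleDl A : {morph herm_scale^~ A : a b / a + b}.
Proof. by move=> a b; apply/val_inj/matrixP=> i j; rewrite !mxE scalerDl. Qed.
HB.instance Definition _ := GRing.Zmodule_isLmodule.Build K herm3
  herm_scaleA herm_scale1 herm_scaleDr herm_scaleDl.

Fact jordan_subproof (A B : herm3) :
  octmx_herm (octmx_scale 2^-1 (octmx_mul A B + octmx_mul B A)).
Proof.
have tr (X Y : herm3) i j : octconj (octmx_mul X Y j i) = octmx_mul Y X i j.
  rewrite !octmx_mulE linear_sum; apply: eq_bigr => k _ /=.
  by rewrite octconjM !hermP.
apply/eqP/matrixP=> i j; rewrite mxE [LHS]mxE !octmx_scaleE linearZ /=.
by congr (_ *: _); rewrite [X in octconj X]mxE linearD /= !tr [RHS]mxE addrC.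
Qed.
Definition jordan (A B : herm3) : herm3 := Herm3 (jordan_subproof A B).

Definition inF4 (g : {linear herm3 -> herm3}) : Prop :=
  bijective g /\ {morph g : A B / jordan A B}.

Lemma inF4_id : inF4 idfun.
Proof. by split=> //; exists id. Qed.

Lemma inF4_comp f g : inF4 f -> inF4 g -> inF4 (f \o g).
Proof.
by move=> [bf mf] [bg mg]; split=> [|A B /=]; [exact: bij_comp | rewrite mg mf].
Qed.

Lemma inF4_inv f : inF4 f ->
  exists g : {linear herm3 -> herm3}, [/\ inF4 g, cancel f g & cancel g f].
Proof.
move=> [[g fK gK] mf].
have lg : linear g by move=> a A B; apply: (can_inj fK); rewrite linearP !gK.
pose g' : {linear herm3 -> herm3} :=
  HB.pack g (GRing.isLinear.Build K herm3 herm3 *:%R g lg).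
exists g'; split=> //; split; first by exists f.
by move=> A B; apply: (can_inj fK); rewrite mf !gK.
Qed.

Definition OP20 (A : herm3) : Prop :=
  [/\ octmx_mul A A = 0, \tr A = 0 & A <> 0].

End Hermitian.

Definition std_nilp (R : rcfType) : 'M[oct R[i]]_3 :=
  \matrix_(i, j) octscal (nth 0 (nth [::] [:: [:: 'i%C;     1; 0];
                                              [::    1; -'i%C; 0];
                                              [::    0;     0; 0]] i) j).

(* Main.v *)
Require Import Defs.
From HB Require Import structures.
From mathcomp Require Import all_boot all_order all_algebra.
From mathcomp Require Import ring complex reals.
Set Implicit Arguments.
Unset Strict Implicit.
Unset Printing Implicit Defensive.
Import GRing.Theory.
Local Open Scope ring_scope.

(** The action of F_4 on square-zero elements is transitive because reflections
    already suffice.  Write a Hermitian matrix as a diagonal (a, b, c) together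
    with octonions x, y, z at the positions (1,2), (2,0), (0,1), so that all
    formulas are invariant under cyclic permutation.

    Two kinds of automorphisms are used: the cyclic permutation
    ([F4equiv_cycle]), and, for every (al, u) with al ^+ 2 + n(u) = 1, the
    conjugation by the involution

      s = / al   u    0 \
          | u^* -al   0 |
          \ 0    0    1 /

    ([F4equiv_reflect]).  The latter fixes c and the trace a + b of the upper
    left block.  On the 9-dimensional space of trace-free blocks (d, z), with
    diagonal (d, -d) and quadratic form d ^+ 2 + n(z), it is minus the
    reflection in the vector (al, u); on the 16-dimensional space of the pairs
    (x, y) it is Clifford multiplication by that vector.  That it respects the
    Jordan product amounts to the alternative laws and a Moufang identity of the
    octonions.  As every scalar has a square root, such
    reflections move (d, z) to any (d', z') of the same length, as soon as the
    sum of the two vectors is anisotropic ([F4block_rotate]); an isotropic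
    nonzero vector is moved to the vector (i, 1), possibly after an auxiliary
    reflection ([F4block_isotropic]).

    Let now A have square zero and be nonzero.  Its trace vanishes by
    Cayley-Hamilton ([sq0_tr]); in particular the set is described by the Jordan
    product alone, and automorphisms preserve it ([inF4_OP20]).  For the normal
    form, suppose first that c is not 0.  The relations coming from A^2 = 0 say
    that the trace-free part of the upper left block has length (c / 2) ^+ 2, so
    it can be rotated to the diagonal vector (c / 2, 0) or (- c / 2, 0).  After
    that z = 0 and one of a, b is 0; the relation (c + a) y = - (z x)^* , or the
    one for x, then kills one more entry, and A lives in a single 2 x 2 block,
    where it is isotropic and can be moved to the vector (i, 1)
    ([F4equiv_std_diag]).  If another diagonal entry is nonzero, permute
    cyclically.  If the diagonal is zero, then all off-diagonal entries are
    isotropic; rotating a nonzero one to (i, 1) creates a nonzero diagonal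
    entry ([F4equiv_std]).

    The argument works over every field of characteristic not 2 in which all
    elements are squares. *)

(** * Octonions in coordinates *)

Section Coordinates.
Variable K : comNzRingType.

Definition quat4 (x0 x1 x2 x3 : K) : 'rV[K]_(cddim 2) :=
  row_mx (row_mx x0%:M x1%:M : 'rV_(cddim 1)) (row_mx x2%:M x3%:M : 'rV_(cddim 1)).
Definition oct8 (x0 x1 x2 x3 x4 x5 x6 x7 : K) : oct K :=
  row_mx (quat4 x0 x1 x2 x3) (quat4 x4 x5 x6 x7).

Lemma cdmul_row k (a b c d : 'rV[K]_(cddim k)) :
  cdmul (row_mx a b : 'rV_(cddim k.+1)) (row_mx c d : 'rV_(cddim k.+1)) =
  row_mx (cdmul a c - cdmul (cdconj d) b) (cdmul d a + cdmul b (cdconj c)).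
Proof. by rewrite /= !row_mxKl !row_mxKr. Qed.

Lemma cdconj_row k (a b : 'rV[K]_(cddim k)) :
  cdconj (row_mx a b : 'rV_(cddim k.+1)) = row_mx (cdconj a) (- b).
Proof. by rewrite /= row_mxKl row_mxKr. Qed.

Lemma quat4_mul x0 x1 x2 x3 y0 y1 y2 y3 :
  cdmul (quat4 x0 x1 x2 x3) (quat4 y0 y1 y2 y3) =
  quat4 (x0 * y0 - x1 * y1 - x2 * y2 - x3 * y3)
        (x0 * y1 + x1 * y0 + x2 * y3 - x3 * y2)
        (x0 * y2 - x1 * y3 + x2 * y0 + x3 * y1)
        (x0 * y3 + x1 * y2 - x2 * y1 + x3 * y0).
Proof.
rewrite /quat4 cdmul_row !cdconj_row !cdmul_row /=.
have sM (x y : K) : x%:M *m y%:M = (x * y)%:M :> 'M_1 by rewrite -scalar_mxM.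
have sN (x : K) : - x%:M = (- x)%:M :> 'M_1 by rewrite raddfN.
have sD (x y : K) : x%:M + y%:M = (x + y)%:M :> 'M_1 by rewrite raddfD.
rewrite !(sN, sM, sD, opp_row_mx, add_row_mx).
by congr (row_mx (row_mx _%:M _%:M) (row_mx _%:M _%:M)); ring.
Qed.

Lemma quat4_conj x0 x1 x2 x3 :
  cdconj (quat4 x0 x1 x2 x3) = quat4 x0 (- x1) (- x2) (- x3).
Proof. by rewrite /quat4 cdconj_row opp_row_mx cdconj_row -!raddfN. Qed.

Lemma quat4D x0 x1 x2 x3 y0 y1 y2 y3 :
  quat4 x0 x1 x2 x3 + quat4 y0 y1 y2 y3 =
  quat4 (x0 + y0) (x1 + y1) (x2 + y2) (x3 + y3).
Proof. by rewrite /quat4 !add_row_mx -!raddfD. Qed.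

Lemma quat4Z c x0 x1 x2 x3 :
  c *: quat4 x0 x1 x2 x3 = quat4 (c * x0) (c * x1) (c * x2) (c * x3).
Proof. by rewrite /quat4 !scale_row_mx !scale_scalar_mx. Qed.

Lemma quat4N x0 x1 x2 x3 :
  - quat4 x0 x1 x2 x3 = quat4 (- x0) (- x1) (- x2) (- x3).
Proof. by rewrite -scaleN1r quat4Z !mulN1r. Qed.

Lemma oct8_mul x0 x1 x2 x3 x4 x5 x6 x7 y0 y1 y2 y3 y4 y5 y6 y7 :
  octmul (oct8 x0 x1 x2 x3 x4 x5 x6 x7) (oct8 y0 y1 y2 y3 y4 y5 y6 y7) =
  oct8
    (x0 * y0 - x1 * y1 - x2 * y2 - x3 * y3 - x4 * y4 - x5 * y5 - x6 * y6 - x7 * y7)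
    (x0 * y1 + x1 * y0 + x2 * y3 - x3 * y2 + x4 * y5 - x5 * y4 - x6 * y7 + x7 * y6)
    (x0 * y2 - x1 * y3 + x2 * y0 + x3 * y1 + x4 * y6 + x5 * y7 - x6 * y4 - x7 * y5)
    (x0 * y3 + x1 * y2 - x2 * y1 + x3 * y0 + x4 * y7 - x5 * y6 + x6 * y5 - x7 * y4)
    (x0 * y4 - x1 * y5 - x2 * y6 - x3 * y7 + x4 * y0 + x5 * y1 + x6 * y2 + x7 * y3)
    (x0 * y5 + x1 * y4 - x2 * y7 + x3 * y6 - x4 * y1 + x5 * y0 - x6 * y3 + x7 * y2)
    (x0 * y6 + x1 * y7 + x2 * y4 - x3 * y5 - x4 * y2 + x5 * y3 + x6 * y0 - x7 * y1)
    (x0 * y7 - x1 * y6 + x2 * y5 + x3 * y4 - x4 * y3 - x5 * y2 + x6 * y1 + x7 * y0).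
Proof.
rewrite octmul.unlock /oct8 cdmul_row !quat4_conj !quat4_mul quat4N !quat4D.
by congr (row_mx (quat4 _ _ _ _) (quat4 _ _ _ _)); ring.
Qed.

Lemma oct8_conj x0 x1 x2 x3 x4 x5 x6 x7 :
  octconj (oct8 x0 x1 x2 x3 x4 x5 x6 x7) =
  oct8 x0 (- x1) (- x2) (- x3) (- x4) (- x5) (- x6) (- x7).
Proof. by rewrite /octconj /oct8 cdconj_row quat4_conj quat4N. Qed.

Lemma oct8D x0 x1 x2 x3 x4 x5 x6 x7 y0 y1 y2 y3 y4 y5 y6 y7 :
  oct8 x0 x1 x2 x3 x4 x5 x6 x7 + oct8 y0 y1 y2 y3 y4 y5 y6 y7 =
  oct8 (x0 + y0) (x1 + y1) (x2 + y2) (x3 + y3)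
       (x4 + y4) (x5 + y5) (x6 + y6) (x7 + y7).
Proof. by rewrite /oct8 add_row_mx !quat4D. Qed.

Lemma oct8Z c x0 x1 x2 x3 x4 x5 x6 x7 :
  c *: oct8 x0 x1 x2 x3 x4 x5 x6 x7 =
  oct8 (c * x0) (c * x1) (c * x2) (c * x3) (c * x4) (c * x5) (c * x6) (c * x7).
Proof. by rewrite /oct8 scale_row_mx !quat4Z. Qed.

Lemma oct8N x0 x1 x2 x3 x4 x5 x6 x7 :
  - oct8 x0 x1 x2 x3 x4 x5 x6 x7 =
  oct8 (- x0) (- x1) (- x2) (- x3) (- x4) (- x5) (- x6) (- x7).
Proof. by rewrite /oct8 opp_row_mx !quat4N. Qed.

Lemma oct8_0 : 0 = oct8 0 0 0 0 0 0 0 0.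
Proof. by rewrite /oct8 /quat4 !(raddf0, row_mx0). Qed.

Lemma oct8_1 : cdone K 3 = oct8 1 0 0 0 0 0 0 0.
Proof. by rewrite /oct8 /quat4 !(raddf0, row_mx0). Qed.

Variant oct8_spec : oct K -> Prop :=
  Oct8Spec x0 x1 x2 x3 x4 x5 x6 x7 : oct8_spec (oct8 x0 x1 x2 x3 x4 x5 x6 x7).

Lemma oct8P (x : oct K) : oct8_spec x.
Proof.
have q4 (q : 'rV[K]_(cddim 2)) : exists x0 x1 x2 x3, q = quat4 x0 x1 x2 x3.
  pose p1 : 'rV[K]_(cddim 1) := lsubmx q; pose p2 : 'rV[K]_(cddim 1) := rsubmx q.
  pose e (t : 'rV[K]_(cddim 0)) := (t : 'M_1) 0 0.
  exists (e (lsubmx p1)), (e (rsubmx p1)), (e (lsubmx p2)), (e (rsubmx p2)).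
  by rewrite /quat4 /e -!mx11_scalar !hsubmxK.
rewrite -[x]hsubmxK.
have [x0 [x1 [x2 [x3 ->]]]] := q4 (lsubmx x).
have [x4 [x5 [x6 [x7 ->]]]] := q4 (rsubmx x).
exact: Oct8Spec.
Qed.

(** The coordinate along 1, found by peeling off the three doublings. *)
Definition octre (x : oct K) : K :=
  (lsubmx (lsubmx (lsubmx x : 'rV_(cddim 2)) : 'rV_(cddim 1)) : 'M_1) 0 0.

Lemma octre8 x0 x1 x2 x3 x4 x5 x6 x7 : octre (oct8 x0 x1 x2 x3 x4 x5 x6 x7) = x0.
Proof. by rewrite /octre !row_mxKl mxE eqxx. Qed.

Lemma octre_linear : linear_for *%R octre.
Proof.
by move=> c x y; case/oct8P: x => *; case/oct8P: y => *; rewrite oct8Z oct8D !octre8.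
Qed.
HB.instance Definition _ := GRing.isLinear.Build K (oct K) K *%R octre octre_linear.

(** The composition form Re (x y^* ), that is, the sum of the x_i y_i. *)
Definition octdot (x y : oct K) : K := octre (octmul x (octconj y)).

Definition oct8E := (oct8_mul, oct8_conj, oct8D, oct8N, oct8Z, octre8).
End Coordinates.

(** * Composition and alternativity identities *)

Section Composition.
Variable K : comNzRingType.
Implicit Types (c : K) (u x y z : oct K).

Lemma octmulDl x y z : octmul (x + y) z = octmul x z + octmul y z.
Proof. by rewrite octmul.unlock cdmulDl. Qed.
Lemma octmulDr x y z : octmul x (y + z) = octmul x y + octmul x z.
Proof. by rewrite octmul.unlock linearD. Qed.
Lemma octmulZl c x y : octmul (c *: x) y = c *: octmul x y.
Proof. by rewrite octmul.unlock cdmulZl. Qed.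
Lemma octmulZr c x y : octmul x (c *: y) = c *: octmul x y.
Proof. by rewrite octmul.unlock cdmulZr. Qed.
Lemma octmulNl x y : octmul (- x) y = - octmul x y.
Proof. by rewrite octmul.unlock cdmulNl. Qed.
Lemma octmulNr x y : octmul x (- y) = - octmul x y.
Proof. by rewrite octmul.unlock cdmulNr. Qed.
Lemma octmul0l y : octmul 0 y = 0.
Proof. by rewrite octmul.unlock cdmul0l. Qed.
Lemma octmul0r x : octmul x 0 = 0.
Proof. by rewrite octmul.unlock linear0. Qed.

Lemma octconjK x : octconj (octconj x) = x.
Proof. exact: cdconjK. Qed.
Lemma octconjD x y : octconj (x + y) = octconj x + octconj y.
Proof. exact: linearD. Qed.
Lemma octconjZ c x : octconj (c *: x) = c *: octconj x.
Proof. exact: linearZ. Qed.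
Lemma octconjN x : octconj (- x) = - octconj x.
Proof. exact: linearN. Qed.
Lemma octconj0 : octconj 0 = 0 :> oct K.
Proof. exact: linear0. Qed.

Lemma octdotC x y : octdot x y = octdot y x.
Proof. by case/oct8P: x => *; case/oct8P: y => *; rewrite /octdot !oct8E; ring. Qed.
Lemma octdotDl x y z : octdot (x + y) z = octdot x z + octdot y z.
Proof. by rewrite /octdot octmulDl linearD. Qed.
Lemma octdotDr x y z : octdot z (x + y) = octdot z x + octdot z y.
Proof. by rewrite !(octdotC z) octdotDl. Qed.
Lemma octdotZl c x y : octdot (c *: x) y = c * octdot x y.
Proof. by rewrite /octdot octmulZl linearZ. Qed.
Lemma octdotZr c x y : octdot y (c *: x) = c * octdot y x.
Proof. by rewrite !(octdotC y) octdotZl. Qed.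
Lemma octdotNl x y : octdot (- x) y = - octdot x y.
Proof. by rewrite /octdot octmulNl linearN. Qed.
Lemma octdotNr x y : octdot y (- x) = - octdot y x.
Proof. by rewrite !(octdotC y) octdotNl. Qed.

Lemma octdot_sqD x y :
  octdot (x + y) (x + y) = octdot x x + octdot x y *+ 2 + octdot y y.
Proof. by rewrite octdotDl !octdotDr (octdotC y x) mulr2n !addrA. Qed.

Lemma octdot_conj x y : octdot (octconj x) (octconj y) = octdot x y.
Proof. by case/oct8P: x => *; case/oct8P: y => *; rewrite /octdot !oct8E; ring. Qed.

Lemma octmul_conj x : octmul x (octconj x) = octscal (octdot x x).
Proof.
case/oct8P: x => *; rewrite /octdot /octscal oct8_1 !oct8E.
by congr oct8; ring.
Qed.

(** This and its mirror image are the form in which the alternative laws are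
    used: left multiplications by u and by its conjugate satisfy the Clifford
    relation. *)
Lemma octmulKl x y : octmul (octconj x) (octmul x y) = octdot x x *: y.
Proof.
case/oct8P: x => *; case/oct8P: y => *; rewrite /octdot !oct8E.
by congr oct8; ring.
Qed.

Lemma octmulKr x y : octmul (octmul y x) (octconj x) = octdot x x *: y.
Proof.
by apply: (can_inj octconjK); rewrite !octconjM octmulKl octconjZ octdot_conj.
Qed.

Lemma octmulKl_polar x y z :
  octmul (octconj x) (octmul y z) + octmul (octconj y) (octmul x z)
  = (octdot x y *+ 2) *: z.
Proof.
case/oct8P: x => *; case/oct8P: y => *; case/oct8P: z => *; rewrite /octdot !oct8E.
by congr oct8; ring.
Qed.

Lemma octdotM x y : octdot (octmul x y) (octmul x y) = octdot x x * octdot y y.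
Proof.
by case/oct8P: x => *; case/oct8P: y => *; rewrite /octdot !oct8E; ring.
Qed.

Lemma octdot_mulr x y z : octdot (octmul x y) z = octdot x (octmul z (octconj y)).
Proof.
case/oct8P: x => *; case/oct8P: y => *; case/oct8P: z => *.
by rewrite /octdot !oct8E; ring.
Qed.

Lemma octmul_moufang u x y :
  octmul (octmul u x) (octmul y u) = octmul u (octmul (octmul x y) u).
Proof.
case/oct8P: u => *; case/oct8P: x => *; case/oct8P: y => *; rewrite !oct8E.
by congr oct8; ring.
Qed.

(** The reason is that u x u = u (x u + u^* x^* ) - u (u^* x^* ), where the bracket
    is the scalar 2 Re (x u) and the last term is n(u) x^*. *)
Lemma octmul_sandwich u x :
  octmul u (octmul x u) =
  (octdot u (octconj x) *+ 2) *: u - octdot u u *: octconj x.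
Proof.
case/oct8P: u => *; case/oct8P: x => *; rewrite /octdot !oct8E.
by congr oct8; ring.
Qed.

Lemma octmulKVl x y : octmul x (octmul (octconj x) y) = octdot x x *: y.
Proof. by rewrite -{1}(octconjK x) octmulKl octdot_conj. Qed.

Lemma octmulKVr x y : octmul (octmul y (octconj x)) x = octdot x x *: y.
Proof. by rewrite -{2}(octconjK x) octmulKr octdot_conj. Qed.

Lemma octmulKr_polar x y z :
  octmul (octmul z x) (octconj y) + octmul (octmul z y) (octconj x)
  = (octdot x y *+ 2) *: z.
Proof.
apply: (can_inj octconjK); rewrite octconjD !octconjM octconjZ.
have := octmulKl_polar (octconj x) (octconj y) (octconj z).
by rewrite octdot_conj !octconjK addrC => <-.
Qed.

Lemma octdot_mull x y z : octdot (octmul x y) z = octdot y (octmul (octconj x) z).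
Proof.
by rewrite -octdot_conj octconjM octdot_mulr octconjK -[LHS]octdot_conj octconjK
  octconjM octconjK.
Qed.
End Composition.

(** * Scalars *)

Section Scal.
Variable K : comNzRingType.

Lemma octre_scal (c : K) : octre (octscal c) = c.
Proof. by rewrite /octscal oct8_1 oct8Z octre8 mulr1. Qed.
Lemma octscal_inj : injective (@octscal K).
Proof. exact: can_inj octre_scal. Qed.
Lemma octscalD (c d : K) : octscal (c + d) = octscal c + octscal d.
Proof. exact: scalerDl. Qed.
Lemma octscalZ (c d : K) : octscal (c * d) = c *: octscal d.
Proof. by rewrite /octscal scalerA. Qed.
Lemma octscal0 : octscal 0 = 0 :> oct K.
Proof. exact: scale0r. Qed.
Lemma octconj_scal (c : K) : octconj (octscal c) = octscal c.
Proof. by rewrite /octscal oct8_1 !oct8E mulr0 oppr0. Qed.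
Lemma octmul_scall (c : K) (x : oct K) : octmul (octscal c) x = c *: x.
Proof. by rewrite octmulZl octmul.unlock (cdmul1 K 3).1. Qed.
Lemma octmul_scalr (c : K) (x : oct K) : octmul x (octscal c) = c *: x.
Proof. by rewrite octmulZr octmul.unlock (cdmul1 K 3).2. Qed.
Lemma octdot_scall (c : K) (x : oct K) : octdot (octscal c) x = c * octre x.
Proof.
by case/oct8P: x => *; rewrite /octdot octmul_scall !oct8E.
Qed.
Lemma octdot0l (x : oct K) : octdot 0 x = 0.
Proof. by rewrite /octdot octmul0l linear0. Qed.
Lemma octmul_conjl (x : oct K) : octmul (octconj x) x = octscal (octdot x x).
Proof. by rewrite -{2}(octconjK x) octmul_conj octdot_conj. Qed.
Lemma octadd_conj (x : oct K) : x + octconj x = octscal (octre x *+ 2).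
Proof.
case/oct8P: x => *; rewrite /octscal oct8_1 !oct8E.
by congr oct8; ring.
Qed.
End Scal.

(** * The Jordan algebra in coordinates *)

Section Herm.
Variable K : fieldType.
Hypothesis two_neq0 : 2 != 0 :> K.
Implicit Types (a b c d t : K) (u x y z : oct K) (A B : herm3 K).

Lemma octconj_fixed x : octconj x = x -> x = octscal (octre x).
Proof.
move=> fx; apply: (scalerI two_neq0); rewrite -octscalZ mulr_natl -octadd_conj fx.
by rewrite scaler_nat.
Qed.

(** The octonions sit at the positions (1,2), (2,0), (0,1): cyclic permutation of
    the indices then permutes (a, b, c) and (x, y, z) without conjugating. *)
Definition hermx a b c x y z : 'M[oct K]_3 :=
  \matrix_(i, j) nth 0 (nth [::] [:: [:: octscal a; z; octconj y];
                                     [:: octconj z; octscal b; x];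
                                     [:: y; octconj x; octscal c]] i) j.

(** Natural indices can be split into cases, and [inordK] then evaluates the
    entries of explicitly given matrices. *)
Lemma matrix3P (T : Type) (M N : 'M[T]_3) :
  (forall i j : nat, (i < 3)%N -> (j < 3)%N ->
     M (inord i) (inord j) = N (inord i) (inord j)) -> M = N.
Proof.
move=> h; apply/matrixP=> i j; have := h i j (ltn_ord i) (ltn_ord j).
by rewrite !inord_val.
Qed.

Fact hermx_herm a b c x y z : octmx_herm (hermx a b c x y z).
Proof.
apply/eqP/matrix3P; do 3?[case=> [|[|[|//]]]] => _ _;
by rewrite !mxE !inordK //= ?octconj_scal ?octconjK.
Qed.
Definition herm a b c x y z : herm3 K := Herm3 (hermx_herm a b c x y z).

Lemma eq_herm a b c x y z a' b' c' x' y' z' :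
  a = a' -> b = b' -> c = c' -> x = x' -> y = y' -> z = z' ->
  herm a b c x y z = herm a' b' c' x' y' z'.
Proof. by do 6!move=> ->. Qed.

Variant herm_spec : herm3 K -> Prop :=
  HermSpec a b c x y z : herm_spec (herm a b c x y z).

Lemma herm_specP A : herm_spec A.
Proof.
pose o (k : nat) : 'I_3 := inord k.
suff -> : A = herm (octre (A (o 0) (o 0))) (octre (A (o 1) (o 1)))
  (octre (A (o 2) (o 2))) (A (o 1) (o 2)) (A (o 2) (o 0)) (A (o 0) (o 1)).
  exact: HermSpec.
apply/val_inj/matrix3P; do 3?[case=> [|[|[|//]]]] => _ _ /=;
by rewrite mxE !inordK //= -?octconj_fixed ?hermP.
Qed.

Lemma hermM a b c x y z :
  octmx_mul (herm a b c x y z) (herm a b c x y z) =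
  herm (a ^+ 2 + octdot z z + octdot y y) (b ^+ 2 + octdot z z + octdot x x)
       (c ^+ 2 + octdot x x + octdot y y)
       ((b + c) *: x + octconj (octmul y z))
       ((c + a) *: y + octconj (octmul z x))
       ((a + b) *: z + octconj (octmul x y)).
Proof.
apply/matrix3P; do 3?[case=> [|[|[|//]]]] => _ _ /=;
rewrite octmx_mulE !mxE !inordK //= !big_ord_recl big_ord0 !mxE /= !inordK //=;
rewrite ?(octmul_conj, octmul_conjl, octmul_scall, octmul_scalr) ?octconjD
  ?octconjZ ?octconjM ?octconjK ?octscalD ?expr2 ?octscalZ ?scalerDl ?addr0;
by apply/rowP=> j; rewrite !mxE; ring.
Qed.

Lemma jordan_sq A : hmx (jordan A A) = octmx_mul A A.
Proof.
apply/matrixP=> i j.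
by rewrite octmx_scaleE mxE -mulr2n -[X in _ *: X]scaler_nat scalerA mulVf ?scale1r.
Qed.

Lemma jordan_herm a b c x y z :
  jordan (herm a b c x y z) (herm a b c x y z) =
  herm (a ^+ 2 + octdot z z + octdot y y) (b ^+ 2 + octdot z z + octdot x x)
       (c ^+ 2 + octdot x x + octdot y y)
       ((b + c) *: x + octconj (octmul y z))
       ((c + a) *: y + octconj (octmul z x))
       ((a + b) *: z + octconj (octmul x y)).
Proof. by apply: val_inj; exact: etrans (jordan_sq _) (hermM _ _ _ _ _ _). Qed.

Lemma jordanC A B : jordan A B = jordan B A.
Proof. by apply: val_inj; congr (octmx_scale _ _); rewrite addrC. Qed.

Lemma jordanDl A B C : jordan (A + B) C = jordan A C + jordan B C.
Proof.
apply/val_inj/matrixP=> i j.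
rewrite [RHS]mxE !octmx_scaleE -scalerDr; congr (_ *: _).
rewrite [LHS]mxE [in RHS]mxE [X in _ = _ + X]mxE !octmx_mulE addrACA -!big_split /=.
by apply: eq_bigr => k _; rewrite !mxE octmulDl octmulDr.
Qed.

(** Polarization: the Jordan product is determined by the squares. *)
Lemma jordan_morph (g : {linear herm3 K -> herm3 K}) :
  (forall A, g (jordan A A) = jordan (g A) (g A)) -> {morph g : A B / jordan A B}.
Proof.
have sqD A B : jordan (A + B) (A + B) = jordan A A + jordan B B + 2 *: jordan A B.
  rewrite jordanDl !(jordanC _ (A + B)) !jordanDl (jordanC B A) scaler_nat mulr2n.
  by rewrite [RHS]addrACA [X in _ = _ + X]addrC.
move=> gsq A B; have := gsq (A + B).
rewrite sqD (linearD g A) sqD 2!linearD linearZZ !gsq.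
by move/addrI/(scalerI two_neq0).
Qed.

Lemma herm_lin k a b c x y z a' b' c' x' y' z' :
  k *: herm a b c x y z + herm a' b' c' x' y' z' =
  herm (k * a + a') (k * b + b') (k * c + c')
       (k *: x + x') (k *: y + y') (k *: z + z').
Proof.
apply/val_inj/matrix3P; do 3?[case=> [|[|[|//]]]] => _ _ /=;
by rewrite !mxE !inordK //= ?octconjD ?octconjZ ?octscalD ?octscalZ.
Qed.

Lemma herm0 : herm 0 0 0 0 0 0 = 0.
Proof.
apply/val_inj/matrix3P; do 3?[case=> [|[|[|//]]]] => _ _ /=;
by rewrite !mxE !inordK //= ?octconj0 ?octscal0.
Qed.

Lemma herm_inj a b c x y z a' b' c' x' y' z' :
  herm a b c x y z = herm a' b' c' x' y' z' ->
  [/\ a = a', b = b' & c = c'] /\ [/\ x = x', y = y' & z = z'].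
Proof.
move=> /(congr1 (@hmx K))/matrixP e.
have {}e i j := e (inord i) (inord j).
have := (e 0 0, e 1 1, e 2 2, e 1 2, e 2 0, e 0 1)%N; rewrite !mxE !inordK //=.
by case=> [[[[[/octscal_inj-> /octscal_inj->] /octscal_inj->] ->] ->] ->].
Qed.

Lemma herm_tr a b c x y z : \tr (herm a b c x y z) = octscal (a + b + c).
Proof. by rewrite /mxtrace !big_ord_recl big_ord0 !mxE /= !octscalD addr0 addrA. Qed.
End Herm.

(** * Elements of F_4 *)

Section F4.
Variable K : fieldType.
Hypothesis two_neq0 : 2 != 0 :> K.
Implicit Types (a b c d t : K) (u x y z : oct K) (A B C : herm3 K).

Definition F4equiv A B :=
  exists g : {linear herm3 K -> herm3 K}, inF4 g /\ g A = B.

Lemma F4equiv_trans B A C : F4equiv A B -> F4equiv B C -> F4equiv A C.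
Proof.
move=> [g [Fg <-]] [h [Fh <-]].
by exists (h \o g : {linear _ -> _}); split; first exact: inF4_comp.
Qed.

Lemma F4equiv_sym A B : F4equiv A B -> F4equiv B A.
Proof.
move=> [g [Fg <-]]; have [h [Fh gK _]] := inF4_inv Fg.
by exists h; rewrite gK.
Qed.

Definition herm_map (F : K -> K -> K -> oct K -> oct K -> oct K -> herm3 K) A :=
  let o (k : nat) : 'I_3 := inord k in
  F (octre (A (o 0) (o 0))) (octre (A (o 1) (o 1))) (octre (A (o 2) (o 2)))
    (A (o 1) (o 2)) (A (o 2) (o 0)) (A (o 0) (o 1)).

Lemma herm_mapE F a b c x y z : herm_map F (herm a b c x y z) = F a b c x y z.
Proof. by rewrite /herm_map !mxE !inordK //= !octre_scal. Qed.

(** To give an element of F_4 it suffices to give a linear bijection in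
    coordinates that commutes with squaring. *)
Lemma F4equiv_of_coord F G :
  (forall k a b c x y z a' b' c' x' y' z',
     F (k * a + a') (k * b + b') (k * c + c')
       (k *: x + x') (k *: y + y') (k *: z + z')
     = k *: F a b c x y z + F a' b' c' x' y' z') ->
  (forall a b c x y z, herm_map G (F a b c x y z) = herm a b c x y z) ->
  (forall a b c x y z, herm_map F (G a b c x y z) = herm a b c x y z) ->
  (forall a b c x y z, let A := herm a b c x y z in
     herm_map F (jordan A A) = jordan (F a b c x y z) (F a b c x y z)) ->
  forall a b c x y z, F4equiv (herm a b c x y z) (F a b c x y z).
Proof.
move=> Flin FK GK Fsq a b c x y z.
have lF : linear (herm_map F).
  move=> k A B; case: (herm_specP two_neq0 A) => *; case: (herm_specP two_neq0 B) => *.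
  by rewrite herm_lin !herm_mapE Flin.
pose g : {linear herm3 K -> herm3 K} :=
  HB.pack (herm_map F) (GRing.isLinear.Build K _ _ *:%R _ lF).
exists g; split; last exact: herm_mapE.
split.
  exists (herm_map G) => A; case: (herm_specP two_neq0 A) => * /=.
    by rewrite herm_mapE FK.
  by rewrite herm_mapE GK.
apply: jordan_morph => // A; case: (herm_specP two_neq0 A) => * /=.
by rewrite herm_mapE Fsq.
Qed.

Lemma F4equiv_cycle a b c x y z : F4equiv (herm a b c x y z) (herm b c a y z x).
Proof.
pose F a b c x y z : herm3 K := herm b c a y z x.
pose G a b c x y z : herm3 K := herm c a b z x y.
apply: (@F4equiv_of_coord F G) => *; rewrite ?herm_mapE /F /G ?herm_lin //.
rewrite !(jordan_herm two_neq0) herm_mapE.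
by apply: eq_herm; rewrite // addrAC.
Qed.

(** The involution s = ((al, u), (u^*, -al)) acts on the block B with rows (a, z),
    (z^*, b) by B |-> s B s = (tr B / 2) + h s - w, where w is the trace-free part
    of B and h is twice the inner product of s and w, and on the column (y^*, x)
    by left multiplication.  The square of the whole matrix is formed from B^2,
    B v + c v, v^* v and v v^*.  The first three are equivariant by the Clifford
    relation s (w v) + w (s v) = h v; for v v^* the diagonal entries need the
    cyclic invariance of Re ((x y) u), and the others the Moufang identity. *)
Lemma F4equiv_reflect al u : al ^+ 2 + octdot u u = 1 ->
  forall a b c x y z, let h := al * (a - b) + octdot u z *+ 2 in
  F4equiv (herm a b c x y z)
    (herm (b + h * al) (a - h * al) c (octconj (octmul y u) - al *: x)
          (al *: y + octconj (octmul u x)) (h *: u - z)).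
Proof.
move=> al_u /=.
pose h a b z := al * (a - b) + octdot u z *+ 2.
pose F a b c x y z := herm (b + h a b z * al) (a - h a b z * al) c
  (octconj (octmul y u) - al *: x) (al *: y + octconj (octmul u x)) (h a b z *: u - z).
have nu : octdot u u = 1 - al ^+ 2 by rewrite -al_u addrAC subrr add0r.
have FK a b c x y z : herm_map F (F a b c x y z) = herm a b c x y z.
  rewrite herm_mapE /F.
  have hF : h (b + h a b z * al) (a - h a b z * al) (h a b z *: u - z) = h a b z.
    by rewrite /h octdotDr octdotZr octdotNr nu; ring.
  rewrite hF; apply: eq_herm; rewrite ?addrK ?subrK ?opprB ?addrK //.
  - rewrite octmulDl octmulZl (octconjM u) octmulKVr nu !(octconjD, octconjZ, octconjK).
    by apply/rowP=> j; rewrite !mxE; ring.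
  - rewrite octmulDr octmulNr octmulZr (octconjM y) octmulKVl nu.
    rewrite !(octconjD, octconjN, octconjZ, octconjK).
    by apply/rowP=> j; rewrite !mxE; ring.
  - by rewrite addrC subrK.
(* [FK] serves for both inverses: s is an involution, hence so is F. *)
apply: (F4equiv_of_coord _ FK FK) => [k a b c x y z a' b' c' x' y' z'|a b c x y z A].
  rewrite /F herm_lin /h octdotDr octdotZr.
  apply: eq_herm;
  rewrite ?octmulDl ?octmulDr ?octmulZl ?octmulZr ?octconjD ?octconjZ; try ring;
  by apply/rowP=> j; rewrite !mxE; ring.
rewrite /A (jordan_herm two_neq0) herm_mapE /F (jordan_herm two_neq0).
(* Both are the trilinear form Re ((x y) u), up to a cyclic permutation. *)
have T1 : octdot y (octconj (octmul u x)) = octdot u (octconj (octmul x y)).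
  by rewrite -octdot_conj octconjK octdotC octdot_mulr octconjM.
have T2 : octdot (octconj (octmul y u)) x = octdot u (octconj (octmul x y)).
  by rewrite -octdot_conj octconjK octdot_mull octconjM.
have Z1 : octdot u ((a + b) *: z + octconj (octmul x y)) =
    (a + b) * octdot u z + octdot u (octconj (octmul x y)).
  by rewrite octdotDr octdotZr.
have nx : octdot (octconj (octmul y u) - al *: x) (octconj (octmul y u) - al *: x)
   = octdot y y * (1 - al ^+ 2) - al * octdot u (octconj (octmul x y)) *+ 2
     + al ^+ 2 * octdot x x.
  rewrite octdot_sqD octdotNr octdotNl octdotNr octdotZl !octdotZr octdot_conj.
  by rewrite octdotM T2 nu; ring.
have ny : octdot (al *: y + octconj (octmul u x)) (al *: y + octconj (octmul u x))
   = al ^+ 2 * octdot y y + al * octdot u (octconj (octmul x y)) *+ 2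
     + octdot x x * (1 - al ^+ 2).
  by rewrite octdot_sqD octdotZl octdotZr octdot_conj octdotM octdotZl T1 nu; ring.
have nz t : octdot (t *: u - z) (t *: u - z)
   = t ^+ 2 * (1 - al ^+ 2) - t * octdot u z *+ 2 + octdot z z.
  by rewrite octdot_sqD octdotNr octdotNl octdotNr octdotZl octdotZr nu octdotZl; ring.
apply: eq_herm.
- by rewrite nz ny /h Z1; ring.
- by rewrite nz nx /h Z1; ring.
- by rewrite nx ny; ring.
- have /(canRL (addrK _)) swap : octmul (octconj u) (octmul z x) +
      octmul (octconj z) (octmul u x) = (octdot u z *+ 2) *: x.
    exact: octmulKl_polar.
  rewrite !(octmulDl, octmulDr, octmulNl, octmulNr, octmulZl, octmulZr).
  rewrite (octconjM u x) octmulKVr nu.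
  rewrite !(octconjD, octconjN, octconjZ) !octconjM !octconjK swap.
  by rewrite /h; apply/rowP=> j; rewrite !mxE; ring.
- have /(canRL (addrK _)) swap : octmul (octmul y z) (octconj u) +
      octmul (octmul y u) (octconj z) = (octdot u z *+ 2) *: y.
    by rewrite octmulKr_polar octdotC.
  rewrite !(octmulDl, octmulDr, octmulNl, octmulNr, octmulZl, octmulZr).
  rewrite (octconjM y u) octmulKVl nu.
  rewrite !(octconjD, octconjN, octconjZ) !octconjM !octconjK swap.
  by rewrite /h; apply/rowP=> j; rewrite !mxE; ring.
- rewrite /h Z1 !(octmulDl, octmulDr, octmulNl, octmulNr, octmulZl, octmulZr).
  rewrite !(octconjD, octconjN, octconjZ) !octconjM !octconjK.
  rewrite octmulKl octmulKr octmul_moufang octmul_sandwich.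
  rewrite nu (octconjM x y).
  by apply/rowP=> j; rewrite !mxE; ring.
Qed.
End F4.

(** * Square-zero elements *)

Section Nilp.
Variable K : fieldType.
Hypothesis two_neq0 : 2 != 0 :> K.
Implicit Types (a b c d t : K) (u x y z : oct K) (A B C : herm3 K).

Lemma herm_sq0 a b c x y z (A := herm a b c x y z) : octmx_mul A A = 0 ->
  [/\ a ^+ 2 + octdot z z + octdot y y = 0, b ^+ 2 + octdot z z + octdot x x = 0
    & c ^+ 2 + octdot x x + octdot y y = 0] /\
  [/\ (b + c) *: x = - octconj (octmul y z), (c + a) *: y = - octconj (octmul z x)
    & (a + b) *: z = - octconj (octmul x y)].
Proof.
rewrite hermM -[0]/(hmx (0 : herm3 K)) -herm0.
move=> /val_inj/herm_inj[[-> -> ->] [/eqP h1 /eqP h2 /eqP h3]].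
by split; split=> //; apply/eqP; rewrite -addr_eq0.
Qed.

(** Multiplying the relation (c + a) y = - (z x)^* by x, and (b + c) x = - (y z)^*
    by y, expresses n(x) z and n(y) z as multiples of z; together with
    c ^+ 2 + n(x) + n(y) = 0 this gives the claim. *)
Lemma sq0_tr_offdiag a b c x y z (A := herm a b c x y z) : octmx_mul A A = 0 ->
  (a + b + c) ^+ 2 *: z = 0.
Proof.
case/herm_sq0=> -[_ _ nc] [ex ey ez].
have h1 : octdot x x *: z = ((c + a) * (a + b)) *: z.
  rewrite -octmulKr -[octmul z x]octconjK -[octconj (octmul z x)]opprK -ey.
  by rewrite octconjN octmulNl octconjZ octmulZl -octconjM -scalerN -ez scalerA.
have h2 : octdot y y *: z = ((b + c) * (a + b)) *: z.
  rewrite -octmulKl -[octmul y z]octconjK -[octconj (octmul y z)]opprK -ex.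
  by rewrite octconjN octmulNr octconjZ octmulZr -octconjM -scalerN -ez scalerA.
have -> : (a + b + c) ^+ 2 = (c + a) * (a + b) + (b + c) * (a + b) + c ^+ 2 by ring.
by rewrite !scalerDl -h1 -h2 -!scalerDl addrC addrA nc scale0r.
Qed.

(** If the trace t were nonzero, then t ^+ 2 would kill no off-diagonal entry but
    0, so A would be diagonal with square zero, hence 0. *)
Lemma sq0_tr a b c x y z (A := herm a b c x y z) : octmx_mul A A = 0 ->
  a + b + c = 0.
Proof.
move=> A0; apply/eqP/negPn/negP => t0.
have cyc a' b' c' x' y' z' :
    octmx_mul (herm a' b' c' x' y' z') (herm a' b' c' x' y' z') = 0 ->
    octmx_mul (herm b' c' a' y' z' x') (herm b' c' a' y' z' x') = 0.
  case/herm_sq0=> -[h1 h2 h3] [h4 h5 h6].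
  by rewrite hermM h4 h5 h6 !addNr (addrAC (b' ^+ 2)) h2 h3 addrAC h1 herm0.
have h0 (v : oct K) s : s = a + b + c -> s ^+ 2 *: v = 0 -> v = 0.
  by move=> -> /eqP; rewrite scaler_eq0 expf_eq0 /= (negPf t0) => /eqP.
have z0 := h0 _ _ (erefl _) (sq0_tr_offdiag A0).
have x0 : x = 0 by apply: h0 (sq0_tr_offdiag (cyc _ _ _ _ _ _ A0)); ring.
have y0 : y = 0.
  by apply: h0 (sq0_tr_offdiag (cyc _ _ _ _ _ _ (cyc _ _ _ _ _ _ A0))); ring.
case/herm_sq0: A0 => -[]; rewrite x0 y0 z0 octdot0l !addr0 => /eqP a0 /eqP b0 /eqP c0 _.
move: a0 b0 c0 t0; rewrite !expf_eq0 /= => /eqP-> /eqP-> /eqP->.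
by rewrite !addr0 eqxx.
Qed.

(** This makes the set visibly invariant under automorphisms of the product. *)
Lemma OP20_sq0 A : OP20 A <-> jordan A A = 0 /\ A <> 0.
Proof.
have sqE : jordan A A = 0 <-> octmx_mul A A = 0.
  split=> [A0|A0]; last by apply: val_inj; rewrite [LHS]jordan_sq.
  by rewrite -(jordan_sq two_neq0) A0.
split=> [[A0 _ An]|[/sqE A0 An]]; first by split; first exact/sqE.
split=> //; case: (herm_specP two_neq0 A) A0 => a b c x y z A0.
by rewrite herm_tr (sq0_tr A0) octscal0.
Qed.

Lemma inF4_OP20 (g : {linear herm3 K -> herm3 K}) A : inF4 g -> OP20 A -> OP20 (g A).
Proof.
move=> [[h gK hK] gM] /OP20_sq0[A0 An]; apply/OP20_sq0; split.
  by rewrite -gM A0 linear0.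
by move=> gA0; apply: An; rewrite -[A]gK gA0 -[RHS]gK linear0.
Qed.

Lemma F4equiv_OP20 A B : F4equiv A B -> OP20 A -> OP20 B.
Proof. by move=> [g [Fg <-]]; apply: inF4_OP20. Qed.

(** * Rotations of a 2 x 2 block *)

Hypothesis sqrt_ex : forall a, exists r, r ^+ 2 = a.

(** [F4equiv_reflect] with the diagonal split into its mean t, which is fixed, and
    the coordinate d of the trace-free part. *)
Lemma F4equiv_reflect_half al u : al ^+ 2 + octdot u u = 1 ->
  forall t d c x y z, let h := (al * d + octdot u z) *+ 2 in
  F4equiv (herm (t + d) (t - d) c x y z)
    (herm (t + (h * al - d)) (t - (h * al - d)) c (octconj (octmul y u) - al *: x)
          (al *: y + octconj (octmul u x)) (h *: u - z)).
Proof.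
move=> al_u t d c x y z /=.
have := F4equiv_reflect two_neq0 al_u (t + d) (t - d) c x y z; rewrite /=.
have -> : al * (t + d - (t - d)) + octdot u z *+ 2 = (al * d + octdot u z) *+ 2 by ring.
set h := (al * d + octdot u z) *+ 2.
have -> : t - d + h * al = t + (h * al - d) by ring.
by have -> : t + d - h * al = t - (h * al - d) by ring.
Qed.

(** The trace-free block (d, z) can be moved to (d', z').  The entries x and y are
    carried along by Clifford multiplication; of these all that matters is that
    zero goes to zero. *)
Definition F4block d z d' z' := forall t c x y, exists x' y',
  F4equiv (herm (t + d) (t - d) c x y z) (herm (t + d') (t - d') c x' y' z') /\
  (x = 0 -> y = 0 -> x' = 0 /\ y' = 0).

Lemma F4block_trans d z d' z' d'' z'' :
  F4block d z d' z' -> F4block d' z' d'' z'' -> F4block d z d'' z''.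
Proof.
move=> m1 m2 t c x y; have [x' [y' [e1 f1]]] := m1 t c x y.
have [x'' [y'' [e2 f2]]] := m2 t c x' y'.
exists x'', y''; split; first exact: F4equiv_trans e1 e2.
by move=> x0 y0; case: (f1 x0 y0).
Qed.

Lemma F4block_reflect al u d z : al ^+ 2 + octdot u u = 1 ->
  let h := (al * d + octdot u z) *+ 2 in F4block d z (h * al - d) (h *: u - z).
Proof.
move=> al_u h t c x y; do 2!eexists; split; first exact: (F4equiv_reflect_half al_u).
by move=> -> ->; rewrite octmul0l octmul0r !scaler0 octconj0 subr0 addr0.
Qed.

(** The reflection in a vector s exchanges w and - w' when s is proportional to
    w + w', so minus that reflection takes w to w'.  The second hypothesis says
    that w + w' is anisotropic, so that it can be normalized. *)
Lemma F4block_rotate d z d' z' :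
  d ^+ 2 + octdot z z = d' ^+ 2 + octdot z' z' ->
  d ^+ 2 + octdot z z + d * d' + octdot z z' != 0 ->
  F4block d z d' z'.
Proof.
move=> eq_q nz.
have [r r2] := sqrt_ex ((d ^+ 2 + octdot z z + d * d' + octdot z z') *+ 2).
(* r ^+ 2 is the value of the quadratic form at w + w'. *)
have r0 : r != 0.
  have: r ^+ 2 != 0 by rewrite r2 -mulr_natl mulf_neq0.
  by rewrite expf_eq0.
pose al := r^-1 * (d + d'); pose u := r^-1 *: (z + z').
have al_u : al ^+ 2 + octdot u u = 1.
  rewrite /al /u octdotZl octdotZr octdot_sqD.
  apply: (mulfI (expf_neq0 2 r0)); rewrite mulr1 [RHS]r2.
  have -> : r ^+ 2 * ((r^-1 * (d + d')) ^+ 2 +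
      r^-1 * (r^-1 * (octdot z z + octdot z z' *+ 2 + octdot z' z')))
    = d ^+ 2 + octdot z z + (d * d' + octdot z z') *+ 2
      + (d' ^+ 2 + octdot z' z') by field.
  by rewrite -eq_q; ring.
have hr : (al * d + octdot u z) *+ 2 = r.
  rewrite /al /u octdotZl octdotDl (octdotC z').
  apply: (mulfI r0); rewrite -expr2 r2.
  have -> : r * ((r^-1 * (d + d') * d + r^-1 * (octdot z z + octdot z z')) *+ 2) =
   ((d + d') * d + (octdot z z + octdot z z')) *+ 2 by field.
  by ring.
have := F4block_reflect d z al_u; rewrite /= hr.
rewrite [r *: u]scalerA mulfV // scale1r addrAC subrr add0r.
by rewrite [r * al]mulrA mulfV // mul1r addrAC subrr add0r.
Qed.

Variable im : K.
Hypothesis im2 : im ^+ 2 = -1.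

Lemma imag_unit z : z != 0 -> octre z = 0 ->
  exists v, [/\ octre v = 0, octdot v v = 1 & octdot v z != 0].
Proof.
case/oct8P: z => z0 z1 z2 z3 z4 z5 z6 z7 + /=; rewrite octre8 => + z00.
rewrite {z0}z00 => nz.
have unit_coord v w : octre v = 0 -> octdot v v = 1 ->
    octdot v (oct8 0 z1 z2 z3 z4 z5 z6 z7) = w -> w != 0 ->
    exists v, [/\ octre v = 0, octdot v v = 1
                & octdot v (oct8 0 z1 z2 z3 z4 z5 z6 z7) != 0].
  by move=> v0 v1 vz w0; exists v; rewrite vz.
have [z10|] := eqVneq z1 0; last first.
  by apply: (unit_coord (oct8 0 1 0 0 0 0 0 0)); rewrite /octdot !oct8E //; ring.
have [z20|] := eqVneq z2 0; last first.
  by apply: (unit_coord (oct8 0 0 1 0 0 0 0 0)); rewrite /octdot !oct8E //; ring.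
have [z30|] := eqVneq z3 0; last first.
  by apply: (unit_coord (oct8 0 0 0 1 0 0 0 0)); rewrite /octdot !oct8E //; ring.
have [z40|] := eqVneq z4 0; last first.
  by apply: (unit_coord (oct8 0 0 0 0 1 0 0 0)); rewrite /octdot !oct8E //; ring.
have [z50|] := eqVneq z5 0; last first.
  by apply: (unit_coord (oct8 0 0 0 0 0 1 0 0)); rewrite /octdot !oct8E //; ring.
have [z60|] := eqVneq z6 0; last first.
  by apply: (unit_coord (oct8 0 0 0 0 0 0 1 0)); rewrite /octdot !oct8E //; ring.
have [z70|] := eqVneq z7 0; last first.
  by apply: (unit_coord (oct8 0 0 0 0 0 0 0 1)); rewrite /octdot !oct8E //; ring.
by case/eqP: nz; rewrite oct8_0 z10 z20 z30 z40 z50 z60 z70.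
Qed.

(** By [F4block_rotate] this is one rotation unless (d, z) is orthogonal to the
    target (i, 1).  In that case a first reflection destroys the orthogonality:
    the one in (1, 0) when d is not 0, and otherwise the one in the unit vector
    (0, (1 + v) / sqrt 2), where v is imaginary and not orthogonal to z. *)
Lemma F4block_isotropic d z : d ^+ 2 + octdot z z = 0 -> d != 0 \/ z != 0 ->
  F4block d z im (octscal 1).
Proof.
move=> q0 nz.
have direct d1 z1 : d1 ^+ 2 + octdot z1 z1 = 0 -> d1 * im + octre z1 != 0 ->
    F4block d1 z1 im (octscal 1).
  move=> q nz1; apply: F4block_rotate; last by rewrite q add0r octdotC octdot_scall mul1r.
  by rewrite q im2 octdot_scall octre_scal mulr1 addNr.
have [im_d|] := eqVneq (d * im + octre z) 0; last exact: direct.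
have via al u : al ^+ 2 + octdot u u = 1 ->
    let h := (al * d + octdot u z) *+ 2 in
    (h * al - d) * im + octre (h *: u - z) != 0 ->
    F4block d z im (octscal 1).
  move=> al_u h nz1; apply: F4block_trans (F4block_reflect d z al_u) (direct _ _ _ nz1).
  have nu : octdot u u = 1 - al ^+ 2 by rewrite -al_u addrAC subrr add0r.
  rewrite octdot_sqD octdotNr octdotNl octdotNr octdotZl octdotZr nu octdotZl.
  by rewrite -q0 /h; ring.
have [d0|d_neq0] := eqVneq d 0; last first.
  apply: (via 1 0); rewrite /= !octdot0l; first by rewrite expr1n addr0.
  rewrite scaler0 sub0r linearN mul1r addr0 mulr1 mulr2n addrK.
  have -> : d * im - octre z = 2 * (d * im) - (d * im + octre z) by ring.
  have : im ^+ 2 != 0 by rewrite im2 oppr_eq0 oner_eq0.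
  by rewrite expf_eq0 im_d subr0 => im0; rewrite !mulf_neq0.
have rz : octre z = 0 by rewrite -im_d d0 mul0r add0r.
have zn : z != 0 by case: nz; rewrite // d0 eqxx.
have [v [v0 v1 vz]] := imag_unit zn rz.
have [r r2] := sqrt_ex 2.
have r0 : r != 0 by have := two_neq0; rewrite -r2 expf_eq0.
apply: (via 0 (r^-1 *: (octscal 1 + v))); rewrite /=.
  rewrite octdotZl octdotZr octdot_sqD !octdot_scall octre_scal v0 v1 mulr1 mulr0 mul0rn.
  have -> : 1 + 0 + 1 = r ^+ 2 by rewrite r2; ring.
  by field.
rewrite d0 !mul0r mulr0 !add0r oppr0 mul0r add0r linearB linearZ /= rz subr0.
rewrite !octdotZl !octdotDl octdot_scall rz mulr0 add0r linearZ linearD /=.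
rewrite octre_scal v0 addr0.
suff -> : (r^-1 * octdot v z *+ 2) * (r^-1 * 1) = octdot v z by [].
by rewrite -mulr_natl -r2; field.
Qed.

(** * The normal form *)

Definition std_herm := herm im (- im) 0 0 0 (octscal 1).

Lemma F4equiv_std_block d z :
  OP20 (herm d (- d) 0 0 0 z) -> F4equiv (herm d (- d) 0 0 0 z) std_herm.
Proof.
case=> sq0 _ An; have [[]] := herm_sq0 sq0.
rewrite octdot0l addr0 => q0 _ _ _.
have nz : d != 0 \/ z != 0.
  apply/orP; rewrite -negb_and; apply/negP => /andP[/eqP d0 /eqP z0].
  by apply: An; rewrite d0 z0 oppr0 herm0.
have [x' [y' [e]]] := F4block_isotropic q0 nz 0 0 0 0.
by case=> // x0 y0; move: e; rewrite x0 y0 !add0r.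
Qed.

Lemma F4equiv_std_cycle a b c x y z :
  (OP20 (herm b c a y z x) -> F4equiv (herm b c a y z x) std_herm) ->
  OP20 (herm a b c x y z) -> F4equiv (herm a b c x y z) std_herm.
Proof.
move=> std OPA; have eqv := F4equiv_cycle two_neq0 a b c x y z.
exact: F4equiv_trans eqv (std (F4equiv_OP20 eqv OPA)).
Qed.

(** The square-zero relations give d ^+ 2 + n(z) = (c / 2) ^+ 2 for the trace-free
    part (d, z) of the upper left block, which therefore rotates to (c / 2, 0) or
    (- c / 2, 0): as c is not 0, at least one of these two targets has an
    anisotropic sum with (d, z).  Since the mean of a and b is - c / 2, one of
    them becomes 0 and the other becomes - c. *)
Lemma F4equiv_std_diag a b c x y z :
  c != 0 -> OP20 (herm a b c x y z) -> F4equiv (herm a b c x y z) std_herm.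
Proof.
move=> c0 OPA; have [sq0 _ _] := OPA.
have [[ea eb ec] _] := herm_sq0 sq0.
have half : 2^-1 * c + 2^-1 * c = c by field.
pose t := 2^-1 * (a + b); pose d := 2^-1 * (a - b).
have at_d : a = t + d by rewrite /t /d; field.
have bt_d : b = t - d by rewrite /t /d; field.
have cE : c = - (a + b) by rewrite -[RHS]addr0 -(sq0_tr sq0) addKr.
have tE : t = - (2^-1 * c) by rewrite cE mulrN opprK.
have q : d ^+ 2 + octdot z z = (2^-1 * c) ^+ 2.
  have zz : octdot z z *+ 2 = c ^+ 2 - a ^+ 2 - b ^+ 2.
    apply/eqP; rewrite -subr_eq0.
    have -> : octdot z z *+ 2 - (c ^+ 2 - a ^+ 2 - b ^+ 2) =
      a ^+ 2 + octdot z z + octdot y y + (b ^+ 2 + octdot z z + octdot x x)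
      - (c ^+ 2 + octdot x x + octdot y y) by ring.
    by rewrite ea eb ec addr0 subr0.
  apply: (mulfI two_neq0).
  have -> : 2 * (d ^+ 2 + octdot z z) = 2 * d ^+ 2 + octdot z z *+ 2 by ring.
  by rewrite zz cE /d; field.
have [x' [y' [d' [d'E eqv]]]] : exists x' y' d',
    (d' = 2^-1 * c \/ d' = - (2^-1 * c)) /\
    F4equiv (herm a b c x y z) (herm (t + d') (t - d') c x' y' 0).
  rewrite at_d bt_d.
  have q' d' : d' = 2^-1 * c \/ d' = - (2^-1 * c) -> d' ^+ 2 = (2^-1 * c) ^+ 2.
    by case=> ->; rewrite ?sqrrN.
  have rot d' : d' = 2^-1 * c \/ d' = - (2^-1 * c) -> d' * (d' + d) != 0 ->
      exists x' y' d', (d' = 2^-1 * c \/ d' = - (2^-1 * c)) /\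
      F4equiv (herm (t + d) (t - d) c x y z) (herm (t + d') (t - d') c x' y' 0).
    move=> d'E nz; have [||x' [y' [eqv _]]] := @F4block_rotate d z d' 0 _ _ t c x y.
    - by rewrite q octdot0l addr0 q'.
    - by rewrite q -(q' d') // octdotC octdot0l addr0 (mulrC d) -mulrDr.
    by exists x', y', d'.
  have half0 : 2^-1 * c != 0 by rewrite mulf_neq0 // invr_eq0.
  have [dc|dc] := eqVneq (2^-1 * c + d) 0; last first.
    by apply: (rot (2^-1 * c)); [left | rewrite mulf_neq0].
  apply: (rot (- (2^-1 * c))); first by right.
  rewrite mulf_neq0 ?oppr_eq0 //; move/eqP: dc; rewrite addrC addr_eq0 => /eqP->.
  by rewrite -opprD oppr_eq0 half.
have OPA' := F4equiv_OP20 eqv OPA; have [sq0' _ _] := OPA'.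
apply: (F4equiv_trans eqv); clear eqv; move: OPA'.
have [_ []] := herm_sq0 sq0'.
rewrite octmul0l octmul0r octconj0 oppr0 => ex ey _.
case: d'E => d'E; rewrite {}d'E tE in ex ey *.
  (* Here a = 0 and z = 0, so the relation for y reads c y = 0. *)
  have -> : y' = 0.
    by move/eqP: ey; rewrite addNr addr0 scaler_eq0 (negPf c0) => /eqP.
  rewrite addNr -opprD half; apply: F4equiv_std_cycle.
  by have := @F4equiv_std_block (- c) x'; rewrite opprK.
(* Here b = 0 and z = 0, so the relation for x reads c x = 0. *)
have -> : x' = 0.
  by move/eqP: ex; rewrite opprK addNr add0r scaler_eq0 (negPf c0) => /eqP.
rewrite opprK addNr -opprD half; do 2!apply: F4equiv_std_cycle.
exact: F4equiv_std_block.
Qed.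

Lemma F4equiv_std A : OP20 A -> F4equiv A std_herm.
Proof.
case: (herm_specP two_neq0 A) => a b c x y z.
have [c0|] := eqVneq c 0; last exact: F4equiv_std_diag.
have [a0|a_neq0] := eqVneq a 0; last first.
  by apply: F4equiv_std_cycle; apply: F4equiv_std_diag.
have [b0|b_neq0] := eqVneq b 0; last first.
  by do 2!apply: F4equiv_std_cycle; apply: F4equiv_std_diag.
rewrite {a}a0 {b}b0 {c}c0.
have offdiag x' y' z' : z' != 0 ->
    OP20 (herm 0 0 0 x' y' z') -> F4equiv (herm 0 0 0 x' y' z') std_herm.
  move=> z0 OPA; have [sq0 _ _] := OPA.
  (* Twice n(z') is an alternating sum of the three diagonal relations. *)
  have q0 : 0 ^+ 2 + octdot z' z' = 0.
    have [[ea eb ec] _] := herm_sq0 sq0.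
    apply: (mulfI two_neq0); rewrite mulr0.
    transitivity (0 ^+ 2 + octdot z' z' + octdot y' y'
      + (0 ^+ 2 + octdot z' z' + octdot x' x')
      - (0 ^+ 2 + octdot x' x' + octdot y' y')); first by ring.
    by rewrite ea eb ec addr0 subr0.
  have [x'' [y'' [eqv _]]] := F4block_isotropic q0 (or_intror z0) 0 0 x' y'.
  rewrite !add0r oppr0 in eqv; apply: (F4equiv_trans eqv).
  apply: F4equiv_std_cycle (F4equiv_OP20 eqv OPA); apply: F4equiv_std_diag.
  have : im ^+ 2 != 0 by rewrite im2 oppr_eq0 oner_eq0.
  by rewrite expf_eq0.
have [z0|] := eqVneq z 0; last exact: offdiag.
have [x0|x_neq0] := eqVneq x 0; last by apply: F4equiv_std_cycle; apply: offdiag.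
have [y0|y_neq0] := eqVneq y 0; last by do 2!apply: F4equiv_std_cycle; apply: offdiag.
by case=> _ _; rewrite x0 y0 z0 herm0.
Qed.

End Nilp.

Lemma OP20_std_herm (K : fieldType) (im : K) :
  2 != 0 :> K -> im ^+ 2 = -1 -> OP20 (std_herm im).
Proof.
move=> two_neq0 im2; apply/(OP20_sq0 two_neq0); split.
  rewrite (jordan_herm two_neq0) !octdot0l !octmul0l !octmul0r !octdot_scall octre_scal.
  rewrite sqrrN im2 mulr1 expr0n !addr0 addNr subrr !scaler0 scale0r octconj0 !addr0.
  exact: herm0.
rewrite -herm0 => /herm_inj[_ [_ _]]; rewrite -octscal0 => /octscal_inj/eqP.
by rewrite oner_eq0.
Qed.

Theorem theorem3p4p2 (R : realType) :
  [/\ (* F_4 acts on the set *)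
      forall (g : {linear herm3 R[i] -> herm3 R[i]}) (A : herm3 R[i]),
        inF4 g -> OP20 A -> OP20 (g A),
      (* transitively *)
      (exists A : herm3 R[i], OP20 A) /\
      (forall A B : herm3 R[i], OP20 A -> OP20 B ->
        exists g : {linear herm3 R[i] -> herm3 R[i]}, inF4 g /\ g A = B)
    & (* normal form *)
      forall A : herm3 R[i], OP20 A ->
        exists g : {linear herm3 R[i] -> herm3 R[i]},
          inF4 g /\ hmx (g A) = std_nilp R].
Proof.
have two_neq0 : 2 != 0 :> R[i] by rewrite Num.Theory.pnatr_eq0.
have i2 : 'i%C ^+ 2 = -1 :> R[i] by exact: sqr_i.
have sqrt_ex (a : R[i]) : exists r, r ^+ 2 = a.
  by eexists; exact: Num.Theory.sqrtCK.
have to_std := F4equiv_std two_neq0 sqrt_ex i2.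
split.
- by move=> g A; exact: inF4_OP20.
- split; first by exists (std_herm 'i%C); exact: OP20_std_herm.
  move=> A B OPA OPB.
  exact: F4equiv_trans (to_std A OPA) (F4equiv_sym (to_std B OPB)).
move=> A /to_std[g [Fg gA]]; exists g; split=> //; rewrite gA.
apply/matrix3P; do 3?[case=> [|[|[|//]]]] => _ _;
by rewrite !mxE !inordK //= ?octconj_scal ?octconj0 ?octscal0.
Qed.
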